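(* For any boolean permutation $v\in\mathfrak{S}_n$, we have $\lambda_2(v)=\textsf{run}(v)$.
   Context: Permutations are composed right to left; $\sigma_i=(i,i+1)$, and a reduced word of a permutation is the sequence of subscripts in a reduced (minimal length) expression as a product of the $\sigma_i$. A permutation is boolean if its reduced words contain no repeated letters (equivalently its principal Bruhat order ideal is a boolean lattice). A run is a sequence of consecutive integers that is either increasing or decreasing, e.g. $a(a+1)\cdots(a+b)$ or $(a+b)\cdots(a+1)a$ with $b\ge0$. For boolean $v$, $\textsf{run}(v)$ is the fewest number of runs whose concatenation is a reduced word for $v$. Under the Robinson–Schensted correspondence (Schensted insertion), $v$ corresponds to a pair of standard Young tableaux of a common shape $\lambda(v)$; $\lambda_i(v)$ denotes the length of the $i$-th row of this shape (zero if there is no such row). *)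

(* Defs.v *)
From mathcomp Require Import all_boot all_fingroup.
Set Implicit Arguments. Unset Strict Implicit. Unset Printing Implicit Defensive.

(* Elements of S_n are permutations of 'I_n = {0,...,n-1}; value k in 'I_n
   stands for k+1 in [n].  The letter i (1 <= i <= n-1) denotes the simple
   transposition sigma_i = (i, i+1), i.e. it swaps the 0-based values i-1, i. *)
Definition sigma (n i : nat) : {perm 'I_n} :=
  match [pick x : 'I_n | val x == i.-1], [pick y : 'I_n | val y == i] with
  | Some x, Some y => tperm x y
  | _, _ => 1%g
  end.

Definition is_word (n : nat) (w : seq nat) : bool := all (fun i => 0 < i < n) w.

(* Product read right to left as functions:
   wprod [:: w1; ...; wk] = sigma_w1 o sigma_w2 o ... o sigma_wk.
   (In MathComp, (p * q) x = q (p x).) *)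
Definition wprod (n : nat) (w : seq nat) : {perm 'I_n} :=
  foldr (fun i p => (p * sigma n i)%g) 1%g w.

Definition reduced_word (n : nat) (v : {perm 'I_n}) (w : seq nat) : Prop :=
  [/\ is_word n w, wprod n w = v &
      forall w', is_word n w' -> wprod n w' = v -> size w <= size w'].

Definition boolean_perm (n : nat) (v : {perm 'I_n}) : Prop :=
  forall w, reduced_word v w -> uniq w.

Definition is_run (s : seq nat) : bool :=
  (0 < size s) &&
  ((s == iota (head 0 s) (size s)) || (rev s == iota (last 0 s) (size s))).

Definition run_decomp (n : nat) (v : {perm 'I_n}) (k : nat) : Prop :=
  exists rs : seq (seq nat),
    [/\ size rs = k, all is_run rs & reduced_word v (flatten rs)].

Definition is_run_number (n : nat) (v : {perm 'I_n}) (k : nat) : Prop :=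
  run_decomp v k /\ forall k', run_decomp v k' -> k <= k'.

Fixpoint bump (r : seq nat) (x : nat) : option (nat * seq nat) :=
  match r with
  | [::] => None
  | y :: r' =>
      if x < y then Some (y, x :: r')
      else match bump r' x with
           | None => None
           | Some (z, r'') => Some (z, y :: r'')
           end
  end.

Fixpoint rs_insert (t : seq (seq nat)) (x : nat) : seq (seq nat) :=
  match t with
  | [::] => [:: [:: x]]
  | r :: t' =>
      match bump r x with
      | None => rcons r x :: t'
      | Some (y, r') => r' :: rs_insert t' y
      end
  end.

Definition one_line (n : nat) (v : {perm 'I_n}) : seq nat :=
  [seq val (v i) | i <- enum 'I_n].

Definition rs_P (n : nat) (v : {perm 'I_n}) : seq (seq nat) :=
  foldl rs_insert [::] (one_line v).

Definition rs_shape (n : nat) (v : {perm 'I_n}) : seq nat := map size (rs_P v).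

(* lambda_i(v), i >= 1; zero if there is no such row *)
Definition lambda_ (n : nat) (v : {perm 'I_n}) (i : nat) : nat :=
  nth 0 (rs_shape v) i.-1.

(* Main.v *)
Require Import Defs.
From mathcomp Require Import all_boot all_fingroup.
From mathcomp Require Import zify.

Set Implicit Arguments. Unset Strict Implicit. Unset Printing Implicit Defensive.

(* A word without repeated letters is determined, up to commutations, by telling
   for each letter m whether it is absent, after m-1, or before m-1. Hence v is
   built from shorter permutations by appending m = 1, ..., n-1 on the right or
   on the left of the word. Appending on the right swaps the last two positions
   of the one-line word, appending on the left swaps the last two values, and in
   both cases Schensted insertion is understood from two bits: whether the last
   entry was appended to the first row, and whether the largest value still lies
   there. The resulting two-bit automaton, which counts the cells of the second
   row, is also the greedy algorithm cutting a word into fewest runs. *)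

(** * Words acting on natural numbers *)

Definition swap (i x : nat) : nat :=
  if x == i.-1 then i else if x == i then i.-1 else x.

Definition wact (w : seq nat) (x : nat) : nat := foldr swap x w.

(** The cases are phrased as plain equations so that [lia] can finish the later computations with
    [swap]. *)
Lemma swap_cases i x :
  (x = i.-1 /\ swap i x = i) \/ (x = i /\ swap i x = i.-1) \/
  (x <> i.-1 /\ x <> i /\ swap i x = x).
Proof. by rewrite /swap; case: eqP => ?; [|case: eqP => ?]; tauto. Qed.

Lemma val_sigma n i (x : 'I_n) : 0 < i < n -> val (sigma n i x) = swap i x.
Proof.
move=> /andP[i0 ilt]; rewrite /sigma.
have i1lt : i.-1 < n by lia.
case: pickP => [y /eqP yE|/(_ (Ordinal i1lt))]; last by rewrite /= eqxx.
case: pickP => [z /eqP zE|/(_ (Ordinal ilt))]; last by rewrite /= eqxx.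
rewrite /swap -yE -zE; case: tpermP => [->|->|/eqP xy /eqP xz].
- by rewrite eqxx.
- rewrite eqxx; case: eqP => //= /esym; lia.
- by rewrite !(inj_eq val_inj) (negPf xy) (negPf xz).
Qed.

Lemma wprod_cat n u w : wprod n (u ++ w) = (wprod n w * wprod n u)%g.
Proof. by elim: u => [|i u IH] /=; rewrite ?mulg1 // IH mulgA. Qed.

Lemma wprod_rcons n w i : wprod n (rcons w i) = (sigma n i * wprod n w)%g.
Proof. by rewrite -cats1 wprod_cat /= mul1g. Qed.

Lemma val_wprod n w (x : 'I_n) : is_word n w -> val (wprod n w x) = wact w x.
Proof.
elim: w => [|i w IH] /=; first by rewrite perm1.
by case/andP=> iw ww; rewrite permM val_sigma // IH.
Qed.

Lemma one_line_wprod n w :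
  is_word n w -> one_line (wprod n w) = map (wact w) (iota 0 n).
Proof.
move=> ww; rewrite /one_line -val_enum_ord -map_comp.
by apply: eq_map => x /=; rewrite val_wprod.
Qed.

Lemma sigma_comm n i j : 0 < i < n -> 0 < j < n -> j.+1 < i ->
  commute (sigma n i) (sigma n j).
Proof.
move=> hi hj lt_ji; apply/permP => x; rewrite !permM; apply: val_inj.
rewrite !val_sigma //.
move: (swap_cases i x) (swap_cases j x) (swap_cases i (swap j x))
  (swap_cases j (swap i x)); lia.
Qed.

(** Letters differing by at least 2 commute, so [i] can pass the letters of [u] one at a time. *)
Lemma wprod_slide n i u : 0 < i < n -> is_word n u ->
  all (fun j => j.+1 < i) u -> wprod n (i :: u) = wprod n (rcons u i).
Proof.
move=> hi; rewrite wprod_rcons /=; elim: u => [|j u IH] /=; first by rewrite mul1g mulg1.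
move=> /andP[hj wu] /andP[lt_ji au].
by rewrite -mulgA -(sigma_comm hi hj lt_ji) mulgA IH // mulgA.
Qed.

(** * Existence of reduced words *)

Definition generated n (v : {perm 'I_n}) := exists2 w, is_word n w & wprod n w = v.

Lemma generatedM n (u v : {perm 'I_n}) :
  generated u -> generated v -> generated (u * v)%g.
Proof.
move=> [a wa <-] [b wb <-]; exists (b ++ a); last by rewrite wprod_cat.
by rewrite /is_word all_cat -/(is_word n a) wa andbT.
Qed.

Lemma sigmaE n i (x y : 'I_n) : x = i :> nat -> y = i.+1 :> nat -> sigma n i.+1 = tperm x y.
Proof.
move=> xE yE; rewrite /sigma /=.
case: pickP => [x' /eqP x'E|/(_ x)]; last by rewrite /= xE eqxx.
case: pickP => [y' /eqP y'E|/(_ y)]; last by rewrite /= yE eqxx.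
by congr tperm; apply: ord_inj; rewrite ?x'E ?y'E.
Qed.

(** Induction on [y]: conjugating the transposition of [x] and [y - 1] by the adjacent transposition
    of [y - 1] and [y] gives the transposition of [x] and [y]. *)
Lemma generated_tperm n (x y : 'I_n) : x < y -> generated (tperm x y).
Proof.
case: y => y; elim: y => // y IH yn /=.
rewrite ltnS leq_eqVlt => /orP[/eqP xE|lt_xy].
  exists [:: y.+1]; first by rewrite /= yn.
  by rewrite /= mul1g (sigmaE xE (y := Ordinal yn)).
have yn' : y < n by lia.
set z := Ordinal yn'.
have gz : generated (tperm z (Ordinal yn)).
  exists [:: y.+1]; first by rewrite /= yn.
  by rewrite /= mul1g (@sigmaE _ y z (Ordinal yn)).
have -> : tperm x (Ordinal yn) = (tperm x z ^ tperm z (Ordinal yn))%g.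
  by rewrite tpermJ tpermL tpermD // -val_eqE /=; lia.
by rewrite conjgE tpermV; apply: generatedM => //; apply: generatedM => //; apply: IH.
Qed.

Lemma generated_perm n (v : {perm 'I_n}) : generated v.
Proof.
have [ts -> /allP tsP] := prod_tpermP v.
elim: ts tsP => [|[x y] ts IH] tsP; first by rewrite big_nil; exists [::].
rewrite big_cons; apply: generatedM; last by apply: IH => t tin; apply: tsP; rewrite in_cons tin orbT.
have := tsP (x, y) (mem_head _ _); rewrite /dpair /= => neq.
have [|] := ltnP x y; first exact: generated_tperm.
rewrite leq_eqVlt val_eqE eq_sym (negPf neq) /= tpermC; exact: generated_tperm.
Qed.

(** All letters lie below [n], so words of length [k] are tuples over the finite type ['I_n]. This
    makes the existence of a word of length [k] decidable, and a least such [k] can be taken. *)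
Lemma reduced_word_exists n (v : {perm 'I_n}) : exists w, reduced_word v w.
Proof.
pose P k := [exists t : k.-tuple 'I_n,
  is_word n (map val t) && (wprod n (map val t) == v)].
have Pword w : is_word n w -> wprod n w = v -> P (size w).
  move=> ww wv; have wE : map val (pmap (insub : nat -> option 'I_n) w) = w.
    rewrite pmap_filter; last exact: insubK.
    by apply/all_filterP/allP => i /(allP ww) /andP[_ ?]; rewrite isSome_insub.
  have sz : size (pmap (insub : nat -> option 'I_n) w) == size w by rewrite -{2}wE size_map.
  by apply/existsP; exists (Tuple sz); rewrite /= wE ww wv eqxx.
have [w0 ww0 w0v] := generated_perm v.
have exP : exists k, P k by exists (size w0); apply: Pword.
case: (ex_minnP exP) => k /existsP[t /andP[wt /eqP tv]] kmin.
exists (map val t); split=> // w' ww' w'v.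
by rewrite size_map size_tuple kmin // Pword.
Qed.

Lemma reduced_word_perm n (v : {perm 'I_n}) w w' :
  reduced_word v w -> perm_eq w' w -> wprod n w' = wprod n w -> reduced_word v w'.
Proof.
move=> [ww wv wmin] pe we; split; first by rewrite /is_word (perm_all _ pe).
  by rewrite we.
by rewrite (perm_size pe).
Qed.

(** * Canonical words and the greedy automaton *)

(* Position of the letter m relative to m-1; [AtRight] also covers the case
   where m occurs and m-1 does not. *)
Inductive side := Absent | AtRight | AtLeft.

Fixpoint build (c : nat -> side) (m : nat) : seq nat :=
  if m is k.+1 then
    match c m with
    | Absent => build c k
    | AtRight => rcons (build c k) m
    | AtLeft => m :: build c k
    end
  else [::].

(* The state [(t, aR, aL)] after the letters up to m: t is the number of runs so
   far, and aR (aL) tells that putting m+1 at the right (left) opens a new run. *)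
Fixpoint greedy (c : nat -> side) (m : nat) : nat * bool * bool :=
  if m is k.+1 then
    let: (t, aR, aL) := greedy c k in
    match c m with
    | Absent => (t, true, true)
    | AtRight => (t + aR, false, ~~ aR)
    | AtLeft => (t + aL, ~~ aL, false)
    end
  else (0, true, true).

Definition cost c m := (greedy c m).1.1.

Definition side_of (w : seq nat) (m : nat) : side :=
  if m \notin w then Absent
  else if subseq [:: m; m.-1] w then AtLeft else AtRight.

Lemma build_letters c m : all (fun i => 0 < i <= m) (build c m).
Proof.
elim: m => //= m IH.
have IH' : all (fun i => 0 < i <= m.+1) (build c m).
  by apply: sub_all IH => i; lia.
by case: (c m.+1); rewrite ?all_rcons /= ?ltnSn.
Qed.

Lemma subseq2_mem (w1 w2 : seq nat) a b :
  a != b -> uniq (w1 ++ a :: w2) -> subseq [:: a; b] (w1 ++ a :: w2) = (b \in w2).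
Proof.
move=> ab; elim: w1 => [|x w1 IH] /=.
  by rewrite eqxx sub1seq.
case/andP=> xN u; rewrite (_ : (a == x) = false) ?IH //.
by apply: contraNF xN => /eqP <-; rewrite mem_cat mem_head orbT.
Qed.

(** Among the letters up to [m+1], only [m] fails to commute with [m+1]. If [m] occurs after [m+1],
    then [m+1] slides to the front; otherwise nothing to its right is [m] and it slides to the
    end. *)
Lemma build_side_of n w m : m <= n.-1 -> is_word n w -> uniq w ->
  perm_eq (filter (leq^~ m) w) (build (side_of w) m) /\
  wprod n (filter (leq^~ m) w) = wprod n (build (side_of w) m).
Proof.
move=> mn ww uw; elim: m mn => [|m IH] mn /=.
  rewrite (@eq_in_filter _ _ pred0) ?filter_pred0 // => i /(allP ww) /=.
  by case: i.
have [pe we] := IH (ltnW mn).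
have -> : side_of w m.+1 = if m.+1 \notin w then Absent
  else if subseq [:: m.+1; m] w then AtLeft else AtRight by [].
case: ifPn => [mw|].
  suff -> : filter (leq^~ m.+1) w = filter (leq^~ m) w by split.
  apply: eq_in_filter => i iw; suff : i != m.+1 by lia.
  by apply: contraNneq mw => <-.
rewrite negbK => mw.
have [w1 [w2 wE]] : exists w1 w2, w = w1 ++ m.+1 :: w2.
  by case/splitPr: mw => w1 w2; exists w1, w2.
have := uw; rewrite {1}wE cat_uniq /= => /and4P[u1 /norP[m1 d12] m2 u2].
have fE (s : seq nat) : m.+1 \notin s -> filter (leq^~ m.+1) s = filter (leq^~ m) s.
  move=> ms; apply: eq_in_filter => i iw; suff : i != m.+1 by lia.
  by apply: contraNneq ms => <-.
have FE : filter (leq^~ m.+1) w = filter (leq^~ m) w1 ++ m.+1 :: filter (leq^~ m) w2.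
  by rewrite wE filter_cat /= leqnn !fE.
have FE' : filter (leq^~ m) w = filter (leq^~ m) w1 ++ filter (leq^~ m) w2.
  by rewrite wE filter_cat /= ltnn.
have mn' : m.+1 < n by lia.
have sl s : {subset s <= w} -> m \notin s ->
    wprod n (m.+1 :: filter (leq^~ m) s) = wprod n (rcons (filter (leq^~ m) s) m.+1).
  move=> sw ms; apply: wprod_slide => //.
    by apply/allP => i; rewrite mem_filter => /andP[_ /sw]; apply: (allP ww).
  apply/allP => i; rewrite mem_filter => /andP[im iin].
  suff : i != m by lia.
  by apply: contraNneq ms => <-.
have sw1 : {subset w1 <= w} by move=> i; rewrite wE mem_cat => ->.
have sw2 : {subset w2 <= w} by move=> i; rewrite wE mem_cat in_cons => ->; rewrite !orbT.
have pm : perm_eq (filter (leq^~ m.+1) w) (m.+1 :: build (side_of w) m).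
  by rewrite FE perm_catC /= perm_cons perm_catC -FE'.
have -> : subseq [:: m.+1; m] w = (m \in w2).
  by rewrite wE subseq2_mem -?wE //; lia.
case: ifPn => mw2; split=> //.
- have mw1 : m \notin w1 by apply: contra d12 => mw1; apply/hasP; exists m.
  by rewrite FE -cat_rcons wprod_cat -sl // -wprod_cat /= -we FE'.
- by rewrite perm_sym perm_rcons perm_sym.
- by rewrite FE wprod_cat sl // -wprod_cat -rcons_cat -FE' !wprod_rcons we.
Qed.

(** * Injectivity and range of the action of a word *)

Lemma swapK i : involutive (swap i).
Proof. by move=> x; move: (swap_cases i x) (swap_cases i (swap i x)); lia. Qed.

Lemma wact_inj w : injective (wact w).
Proof. by elim: w => //= i w IH x y /(inv_inj (@swapK i)) /IH. Qed.

Lemma wact_rcons w i x : wact (rcons w i) x = wact w (swap i x).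
Proof. by rewrite /wact foldr_rcons. Qed.

Lemma wact_le w m x : all (fun i => 0 < i <= m) w -> x <= m -> wact w x <= m.
Proof.
move=> + xm; elim: w => //= i w IH /andP[im /IH].
by move: (swap_cases i (wact w x)); lia.
Qed.

Lemma wact_gt w m x : all (fun i => 0 < i <= m) w -> m < x -> wact w x = x.
Proof.
move=> + xm; elim: w => //= i w IH /andP[im /IH ->].
by move: (swap_cases i x); lia.
Qed.

(** * Schensted insertion *)

Lemma bump_None r x : (Defs.bump r x == None) = all (leq^~ x) r.
Proof.
elim: r => //= y r <-; rewrite ltnNge; case: (leqP y x) => //= _.
by case: (Defs.bump r x) => [[]|].
Qed.

(** The scan stops at the first entry exceeding [x], so whatever is appended behind that entry is
    never compared. *)
Lemma bump_rcons_Some r x z y r' : Defs.bump r x = Some (y, r') ->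
  Defs.bump (rcons r z) x = Some (y, rcons r' z).
Proof.
elim: r r' => //= a r IH r'; case: ifP => _; first by case=> -> <-.
by case: (Defs.bump r x) IH => [[b s]|] // IH [yE <-]; rewrite yE in IH; rewrite (IH s) ?yE.
Qed.

Lemma bump_rcons_None r x z : all (leq^~ x) r -> x < z ->
  Defs.bump (rcons r z) x = Some (z, rcons r x).
Proof.
move=> + xz; elim: r => [|y r IH] /=; first by rewrite xz.
by case/andP=> yx /IH ->; rewrite ltnNge yx.
Qed.

Lemma bump_perm r x y r' :
  Defs.bump r x = Some (y, r') -> perm_eq (y :: r') (x :: r).
Proof.
elim: r r' => //= a r IH r'; case: ifP => _.
  by case=> -> <-; apply/seq.permP => p /=; rewrite addnCA.
case: (Defs.bump r x) IH => [[b s]|] // IH [yE <-]; rewrite yE in IH.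
have /seq.permP IHp := IH _ erefl.
by apply/seq.permP => p; move: (IHp p) => /=; lia.
Qed.

(** Insertion only compares entries, so a strictly increasing relabelling commutes with it. *)
Lemma bump_map (g : nat -> nat) r x : {mono g : a b / a < b} ->
  Defs.bump (map g r) (g x) =
  omap (fun p => (g p.1, map g p.2)) (Defs.bump r x).
Proof.
move=> gm; elim: r => //= y r ->; rewrite gm; case: ifP => // _.
by case: (Defs.bump r x) => [[]|].
Qed.

Lemma rs_insertE t x : rs_insert t x =
  match Defs.bump (head [::] t) x with
  | None => rcons (head [::] t) x :: behead t
  | Some (y, r') => r' :: rs_insert (behead t) y
  end.
Proof. by case: t. Qed.

Lemma rs_insert_append t x : all (leq^~ x) (head [::] t) ->
  rs_insert t x = rcons (head [::] t) x :: behead t.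
Proof. by rewrite rs_insertE -bump_None => /eqP ->. Qed.

Lemma rs_insert_perm t x : perm_eq (flatten (rs_insert t x)) (x :: flatten t).
Proof.
elim: t x => //= r t IH x; case E: (Defs.bump r x) => [[y r']|] /=.
  have /seq.permP IHp := IH y; have /seq.permP bP := bump_perm E.
  apply/seq.permP => p; move: (IHp p) (bP p); rewrite /= !count_cat /=; lia.
by apply/seq.permP => p; rewrite /= !count_cat -cats1 count_cat /=; lia.
Qed.

(** Insertion preserves the multiset of entries; bounds and distinctness of tableau entries are
    drawn from this. *)
Lemma foldl_rs_insert_perm t s :
  perm_eq (flatten (foldl rs_insert t s)) (flatten t ++ s).
Proof.
elim: s t => [|x s IH] t /=; first by rewrite cats0.
rewrite (perm_trans (IH _)) //; have /seq.permP IHp := rs_insert_perm t x.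
by apply/seq.permP => p; move: (IHp p); rewrite !count_cat /=; lia.
Qed.

Lemma rs_insert_map g t x : {mono g : a b / a < b} ->
  rs_insert (map (map g) t) (g x) = map (map g) (rs_insert t x).
Proof.
move=> gm; elim: t x => //= r t IH x; rewrite bump_map //.
by case: (Defs.bump r x) => [[y r']|] /=; rewrite ?IH ?map_rcons.
Qed.

Lemma foldl_rs_insert_map g t s : {mono g : a b / a < b} ->
  foldl rs_insert (map (map g) t) (map g s) = map (map g) (foldl rs_insert t s).
Proof. by move=> gm; elim: s t => //= x s IH t; rewrite rs_insert_map. Qed.

Lemma map_bump_id m r : all (leq^~ m) r -> m \notin r -> map (fintype.bump m) r = r.
Proof.
move=> /allP rm mr; rewrite -[RHS]map_id; apply/eq_in_map => y yr.
have : y != m by apply: contraNneq mr => <-.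
by have := rm _ yr; rewrite /bump; lia.
Qed.

(** After relabelling, the maximum [m] has become [m+1], the only entry above [m]. Inserting [m]
    therefore expels it and restores the original row. *)
Lemma bump_shifted_max m r : all (leq^~ m) r -> uniq r -> m \in r ->
  Defs.bump (map (fintype.bump m) r) m = Some (m.+1, r).
Proof.
elim: r => //= a r IH /andP[am rm] /andP[ar ur]; rewrite in_cons.
have [ma _|ma /= mr] := eqVneq m a.
  by rewrite -ma in ar *; rewrite map_bump_id // /fintype.bump leqnn ltnSn.
rewrite IH // /fintype.bump; have -> : (m <= a) = false by lia.
by rewrite add0n ltnNge am.
Qed.

Lemma head_map (g : nat -> nat) t :
  head [::] (map (map g) t) = map g (head [::] t).
Proof. by case: t. Qed.

(** * The automaton read off the insertion tableau *)

Definition tableau w m := foldl rs_insert [::] (map (wact w) (iota 0 m)).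

Lemma tableauS w m : tableau w m.+1 = rs_insert (tableau w m) (wact w m).
Proof. by rewrite /tableau -addn1 iotaD map_cat foldl_cat. Qed.

Lemma tableau_uniq w m : uniq (flatten (tableau w m)).
Proof.
rewrite (perm_uniq (foldl_rs_insert_perm _ _)) /=.
by rewrite map_inj_uniq ?iota_uniq //; apply: wact_inj.
Qed.

Lemma mem_row (t : seq (seq nat)) :
  {subset head [::] t <= flatten t} /\ {subset head [::] (behead t) <= flatten t}.
Proof.
case: t => [|r [|s t]]; split=> x //=; rewrite ?mem_cat => -> //.
by rewrite orbT.
Qed.

(* The bits of the greedy state read off the two tableaux: the last entry of the
   one-line word was appended to the first row (the largest cell of Q lies in
   row 1), respectively the largest value lies in row 1 of P. *)
Lemma greedy_tableau c m :
  let w := build c m in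
  greedy c m = (size (head [::] (behead (tableau w m.+1))),
                all (leq^~ (wact w m)) (head [::] (tableau w m)),
                m \in head [::] (tableau w m.+1)).
Proof.
elim: m => [|m IH]; first by [].
rewrite [greedy _ _]/= IH /=.
have wl := build_letters c m; set w := build c m in wl *.
set x := wact w m; set T' := tableau w m; set T := tableau w m.+1.
have xm : x <= m by apply: wact_le.
have TE : T = rs_insert T' x by rewrite -tableauS.
have inT k y : y \in flatten (tableau w k) -> k <= m.+1 -> y <= m.
  rewrite (perm_mem (foldl_rs_insert_perm _ _)) /= => /mapP[z].
  rewrite mem_iota => zk -> km; apply: wact_le => //; lia.
have rowle k z : k <= m.+1 -> m <= z ->
    all (leq^~ z) (head [::] (tableau w k)) /\
    all (leq^~ z) (head [::] (behead (tableau w k))).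
  move=> km mz; have [s1 s2] := mem_row (tableau w k).
  by split; apply/allP => y yin; apply: leq_trans mz; apply: (inT k) => //; auto.
have [le1 le2] := rowle m m.+1 (leqnSn _) (leqnSn _).
have [leT1 leT2] := rowle m.+1 m.+1 (leqnn _) (leqnSn _).
have notin s : all (leq^~ m) s -> m.+1 \in s = false.
  by move=> /allP al; apply/negP => /al; rewrite ltnn.
have [le1m _] := rowle m m (leqnSn _) (leqnn _).
have [leT1m leT2m] := rowle m.+1 m (leqnn _) (leqnn _).
case: (c m.+1).
- have xE : wact w m.+1 = m.+1 by apply: wact_gt wl _.
  rewrite tableauS xE -/T rs_insert_append //=.
  by rewrite leT1 mem_rcons mem_head.
(* A letter on the right swaps the last two positions: the first [m] entries are untouched, then
   [m+1] is inserted, and [x] last. *)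
- have t'E : tableau (rcons w m.+1) m = T'.
    congr foldl; apply/eq_in_map => y; rewrite mem_iota wact_rcons => ym.
    by congr wact; move: (swap_cases m.+1 y); lia.
  have s1 : swap m.+1 m = m.+1 by rewrite /swap eqxx.
  have s2 : swap m.+1 m.+1 = m by rewrite /swap eqxx; case: eqP => //=; lia.
  have xE : wact w m.+1 = m.+1 by apply: wact_gt wl _.
  rewrite !(tableauS (rcons _ _)) t'E !wact_rcons s1 s2 xE -/x.
  rewrite (rs_insert_append le1) /= all_rcons [m < x]ltnNge xm /=.
  rewrite TE rs_insertE -bump_None.
  (* If [x] bumps an entry of the old first row, the trailing [m+1] changes nothing. Otherwise [x]
     bumps [m+1] itself, which lands at the end of the second row as a new cell. *)
  case E: (Defs.bump (head [::] T') x) => [[y r']|] /=.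
    by rewrite (bump_rcons_Some _ E) /= addn0 mem_rcons mem_head.
  rewrite bump_rcons_None -?bump_None ?E //= rs_insert_append //= size_rcons addn1.
  by rewrite notin // all_rcons xm.
- have gm : {mono fintype.bump m : a b / a < b}.
    by move=> a b; rewrite /bump; lia.
  (* A letter on the left swaps the values [m] and [m+1]: the first [m+1] entries are those of [w]
     with [m] renamed [m+1], and the last entry is [m]. *)
  have t'E : tableau (m.+1 :: w) m.+1 = map (map (fintype.bump m)) T.
    rewrite -foldl_rs_insert_map // -map_comp; congr foldl.
    apply/eq_in_map => y; rewrite mem_iota => ym /=.
    have := wact_le wl (_ : y <= m); rewrite /bump.
    by move: (swap_cases m.+1 (wact w y)); lia.
  have xE : wact (m.+1 :: w) m.+1 = m.
    by rewrite /= (wact_gt wl) // /swap eqxx; case: eqP => //=; lia.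
  have uT : uniq (head [::] T).
    have := tableau_uniq w m.+1; rewrite -/T.
    by case: (T) => //= r t; rewrite cat_uniq => /and3P[].
  rewrite (tableauS _ m.+1) t'E xE rs_insertE !head_map.
  (* If the old maximum lies in the first row, its renamed copy [m+1] is bumped to the end of the
     second row. Otherwise [m] is simply appended to the first row. *)
  case: (boolP (m \in _)) => mT /=.
    rewrite bump_shifted_max // rs_insert_append /=; last first.
      rewrite behead_map head_map; apply/allP => _ /mapP[y /(allP leT2m) ym ->].
      by rewrite /fintype.bump; lia.
    rewrite behead_map head_map size_rcons size_map addn1 notin //.
    congr (_, _, _); apply/esym/negbTE/allPn; exists m.+1; last by rewrite ltnn.
    by apply/mapP; exists m; rewrite // /fintype.bump leqnn.
  rewrite map_bump_id //.
  have /eqP -> : Defs.bump (head [::] T) m == None by rewrite bump_None.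
  rewrite /= behead_map head_map size_map addn0 leT1m.
  by rewrite notin // all_rcons leqnn.
Qed.

Lemma build_word n w : is_word n w -> uniq w ->
  perm_eq w (build (side_of w) n.-1) /\
  wprod n w = wprod n (build (side_of w) n.-1).
Proof.
move=> ww uw; have := build_side_of (leqnn n.-1) ww uw.
suff -> : filter (leq^~ n.-1) w = w by [].
by apply/all_filterP/allP => i /(allP ww); lia.
Qed.

Lemma lambda2_cost n w : is_word n w -> uniq w ->
  lambda_ (wprod n w) 2 = cost (side_of w) n.-1.
Proof.
move=> ww uw; have [pe we] := build_word ww uw.
have wb : is_word n (build (side_of w) n.-1) by rewrite /is_word -(perm_all _ pe).
rewrite /lambda_ /rs_shape /rs_P we one_line_wprod // /cost greedy_tableau.
(* For [n = 0] both sides are 0; otherwise the state at [n-1] describes the tableau of all [n]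
   entries. *)
case: n {pe we wb ww} => [//|n]; rewrite [n.+1.-1]/= -/(tableau _ n.+1).
by case: (tableau _ n.+1) => [|r [|s t]].
Qed.

(** * A decomposition into as many runs as the greedy count *)

Lemma build_uniq c m : uniq (build c m).
Proof.
elim: m => //= m IH.
have mN : m.+1 \notin build c m.
  by apply/negP => /(allP (build_letters c m)); rewrite ltnn andbF.
by case: (c m.+1); rewrite ?rcons_uniq /= ?mN.
Qed.

Lemma is_run_iota a k : is_run (iota a k.+1).
Proof. by rewrite /is_run size_iota eqxx. Qed.

Lemma last_rev_iotaS x a k : last x (rev (iota a k.+1)) = a.
Proof. by rewrite /= rev_cons last_rcons. Qed.

Lemma is_run_rev_iota a k : is_run (rev (iota a k.+1)).
Proof. by rewrite /is_run size_rev size_iota revK last_rev_iotaS eqxx orbT. Qed.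

Lemma flatten_cat_cons (A B : seq (seq nat)) r :
  flatten (A ++ r :: B) = flatten A ++ r ++ flatten B.
Proof. by rewrite flatten_cat. Qed.

(** The last clauses carry the induction: a false bit for the right (left) guarantees an increasing
    (decreasing) run with top letter [m], which [m+1] can extend instead of opening a new run. *)
Lemma greedy_runs n c m : m <= n.-1 ->
  exists rs,
  [/\ size rs = cost c m, all is_run rs,
      perm_eq (flatten rs) (build c m),
      wprod n (flatten rs) = wprod n (build c m) &
      (~~ (greedy c m).1.2 -> exists A a k B,
         rs = A ++ iota a k.+1 :: B /\ a + k = m) /\
      (~~ (greedy c m).2 -> exists A a k B,
         rs = A ++ rev (iota a k.+1) :: B /\ a + k = m)].
Proof.
rewrite /cost; elim: m => [|m IH] mn; first by exists [::].
have [rs] := IH (ltnW mn); rewrite /=.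
have lb := build_letters c m; have ub := build_uniq c m.
set w := build c m in lb ub *.
case: (greedy c m) => [[t aR] aL] /= [sz runs pe we [hR hL]].
have le_rs : {in flatten rs, forall i, 0 < i <= m}.
  by move=> i; rewrite (perm_mem pe) => /(allP lb).
rewrite -(perm_uniq pe) in ub.
have mn' : m.+1 < n by lia.
have sl s : {subset s <= flatten rs} -> m \notin s ->
    wprod n (m.+1 :: s) = wprod n (rcons s m.+1).
  move=> sw ms; apply: wprod_slide => //.
    by apply/allP => i /sw /le_rs; lia.
  apply/allP => i iin; have := le_rs i (sw i iin).
  suff : i != m by lia.
  by apply: contraNneq ms => <-.
case: (c m.+1) => /=.
- by exists rs.
- case: aR hR => [_|/(_ isT) [A [a [k [B [rsE akm]]]]]].
    exists (rcons rs [:: m.+1]); split=> //.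
    + by rewrite size_rcons sz addn1.
    + by rewrite all_rcons runs andbT; apply: (is_run_iota m.+1 0).
    + by rewrite flatten_rcons -(cats1 w) perm_cat2r.
    + by rewrite flatten_rcons cats1 !wprod_rcons we.
    (* A one-letter run is both increasing and decreasing, so it may be extended on either side. *)
    + by split=> _; exists rs, m.+1, 0, [::]; rewrite cats1 addn0.
  (* The letter [m] lies in the extended run and, by uniqueness, not in [B]; hence [m+1] commutes
     past [B]. *)
  rewrite -/(iota a k.+1) in rsE; exists (A ++ iota a k.+2 :: B).
  have rE : iota a k.+2 = rcons (iota a k.+1) m.+1.
    by rewrite -cats1 -(addn1 k.+1) iotaD /= addnS akm.
  have fE : flatten (A ++ iota a k.+2 :: B) =
      (flatten A ++ iota a k.+1) ++ m.+1 :: flatten B.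
    by rewrite flatten_cat_cons rE cat_rcons catA.
  have fE' : flatten rs = (flatten A ++ iota a k.+1) ++ flatten B.
    by rewrite rsE flatten_cat_cons catA.
  split=> //.
  + by rewrite -sz rsE !size_cat addn0.
  + by move: runs; rewrite rsE !all_cat => /and3P[-> _ runsB]; rewrite -cat1s all_cat all_seq1 is_run_iota.
  + by rewrite fE perm_catC /= perm_sym perm_rcons perm_cons perm_sym perm_catC -fE'.
  + rewrite fE wprod_cat sl -?wprod_cat -?rcons_cat -?fE' ?wprod_rcons ?we //.
      by move=> i; rewrite fE' mem_cat => ->; rewrite orbT.
    move: ub; rewrite fE' cat_uniq => /and3P[_ /hasPn h _].
    apply/negP => /h; rewrite mem_cat mem_iota; lia.
  + by split=> // _; exists A, a, k.+1, B; split=> //; lia.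
- case: aL hL => [_|/(_ isT) [A [a [k [B [rsE akm]]]]]].
    exists ([:: m.+1] :: rs); split=> //=.
    + by rewrite sz addn1.
    + by rewrite runs andbT; apply: (is_run_iota m.+1 0).
    + by rewrite perm_cons.
    + by rewrite we.
    + by split=> _; exists [::], m.+1, 0, rs; rewrite addn0.
  rewrite -/(iota a k.+1) in rsE; exists (A ++ rev (iota a k.+2) :: B).
  have rE : rev (iota a k.+2) = m.+1 :: rev (iota a k.+1).
    by rewrite -(addn1 k.+1) iotaD rev_cat /= addnS akm.
  have fE : flatten (A ++ rev (iota a k.+2) :: B) =
      flatten A ++ m.+1 :: (rev (iota a k.+1) ++ flatten B).
    by rewrite flatten_cat_cons rE.
  have fE' : flatten rs = flatten A ++ (rev (iota a k.+1) ++ flatten B).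
    by rewrite rsE flatten_cat_cons.
  split=> //.
  + by rewrite -sz rsE !size_cat addn0.
  + by move: runs; rewrite rsE !all_cat => /and3P[-> _ runsB]; rewrite -cat1s all_cat all_seq1 is_run_rev_iota.
  + by rewrite fE perm_catC /= perm_cons perm_catC -fE'.
  + rewrite fE -cat_rcons wprod_cat -sl -?wprod_cat /= -?fE' ?we //.
      by move=> i; rewrite fE' mem_cat => ->.
    move: ub; rewrite fE' cat_uniq => /and3P[_ /hasPn h _].
    apply/negP => mA; have /h : m \in rev (iota a k.+1) ++ flatten B.
      by rewrite mem_cat mem_rev mem_iota; lia.
    by rewrite mA.
  + by split=> // _; exists A, a, k.+1, B; split=> //; lia.
Qed.

(** * Every decomposition has at least the greedy number of runs *)

(* [start j] stands for: j is the least letter of its run, so that counting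
   starts counts runs. *)
Lemma cost_le_starts (c : nat -> side) (start : pred nat) m :
  (forall j, 0 < j <= m -> c j <> Absent -> ~~ start j ->
     [/\ 1 < j, c j.-1 <> Absent & start j.-1 \/ c j.-1 = c j]) ->
  cost c m <= count start (iota 1 m).
Proof.
rewrite /cost => h.
(* Strengthened for the induction: a letter that is not a start keeps the side of its predecessor
   unless that predecessor is a start. In exactly these situations the count must already pay for a
   run opened on that side. *)
suff [] : [/\ (greedy c m).1.1 <= count start (iota 1 m),
   (0 < m -> c m = AtRight \/ (start m /\ c m <> Absent) ->
     (greedy c m).1.1 + (greedy c m).1.2 <= count start (iota 1 m)) &
   (0 < m -> c m = AtLeft \/ (start m /\ c m <> Absent) ->
     (greedy c m).1.1 + (greedy c m).2 <= count start (iota 1 m))] by [].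
elim: m h => [|m IH] h //.
have [|t_le tR tL] := IH; first by move=> j jm; apply: h; lia.
have hm := h m.+1 (leqnn _); have -> : iota 1 m.+1 = iota 1 m ++ [:: m.+1] by rewrite -[LHS]/(iota 1 (1 + m)) addnC iotaD.
rewrite count_cat /= addn0; move: t_le tR tL => /=.
case: (greedy c m) => [[t aR] aL] /= t_le tR tL.
case: (boolP (start m.+1)) hm => sm hm; rewrite ?addn1 ?addn0.
  (* A new start pays 1, which covers [aR + ~~ aR] or [aL + ~~ aL]. *)
  by case cm: (c m.+1) => /=; split; try lia; case: (aR) (aL) => [] []; lia.
case cm: (c m.+1) hm => hm /=.
- by split=> [||]; try lia; move=> _ [|[]].
- have [//|//|m0 cm' so] := hm.
  have le : t + aR <= count start (iota 1 m) by apply: tR => //; tauto.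
  by split=> //; [rewrite addn0 | move=> _ [|[]]].
- have [//|//|m0 cm' so] := hm.
  have le : t + aL <= count start (iota 1 m) by apply: tL => //; tauto.
  by split=> //; [move=> _ [|[]] | rewrite addn0].
Qed.

Lemma subseq_flatten (r : seq nat) rs : r \in rs -> subseq r (flatten rs).
Proof.
case/splitPr => A B; rewrite flatten_cat /=.
by apply: subseq_trans (suffix_subseq _ _); apply: prefix_subseq.
Qed.

Lemma subseq_iota2 a k i : a < i -> i < a + k -> subseq [:: i.-1; i] (iota a k).
Proof.
move=> ai ik; have -> : k = (i.-1 - a) + (2 + (a + k - i.+1)) by lia.
rewrite iotaD; apply: subseq_trans (suffix_subseq _ _).
have -> : a + (i.-1 - a) = i.-1 by lia.
rewrite iotaD; apply: subseq_trans (prefix_subseq _ _).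
by rewrite /= prednK ?eqxx //; lia.
Qed.

Lemma subseq2_asym (w : seq nat) a b : uniq w -> a != b ->
  subseq [:: a; b] w -> subseq [:: b; a] w = false.
Proof.
move=> uw ab /(subseq_uniqP uw) e1; apply/negP => /(subseq_uniqP uw) e2.
have : [:: a; b] = [:: b; a].
  by rewrite e1 [RHS]e2; apply: eq_filter => x; rewrite !inE orbC.
by case=> /eqP; rewrite (negPf ab).
Qed.

Lemma last_iotaS x a k : last x (iota a k.+1) = a + k.
Proof. by rewrite -nth_last size_iota nth_iota. Qed.

Lemma head_rev_iotaS x a k : head x (rev (iota a k.+1)) = a + k.
Proof. by rewrite -nth0 nth_rev size_iota // subn1 nth_iota. Qed.

(** The starts are taken to be the least letters of the runs, at most one for each run. Any other
    letter has its predecessor in the same run, on the side dictated by the direction of that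
    run. *)
Lemma cost_le_runs n rs : is_word n (flatten rs) -> uniq (flatten rs) ->
  all is_run rs -> cost (side_of (flatten rs)) n.-1 <= size rs.
Proof.
set w := flatten rs => ww uw runs.
pose low (r : seq nat) := minn (head 0 r) (last 0 r).
have sideE r i : r \in rs -> i \in r -> i != low r ->
    [/\ 1 < i, i.-1 \in r & side_of w i =
      if r == iota (head 0 r) (size r) then AtRight else AtLeft].
  move=> rin ir il; have rw := subseq_flatten rin.
  have iw : i \in w by apply: (mem_subseq rw).
  have pos j : j \in r -> 0 < j by move=> /(mem_subseq rw) /(allP ww) /andP[].
  have := allP runs _ rin => /andP[r0].
  rewrite /side_of iw /=; case: eqP => [rE _|_ /= /eqP rE].
    have [a [k rI]] : exists a k, r = iota a k.+1.
      by exists (head 0 r), (size r).-1; rewrite prednK.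
    move: ir il rw; rewrite /low rI last_iotaS mem_iota /= => ir il rw.
    have lt_ai : a < i by lia.
    have s2 : subseq [:: i.-1; i] (iota a k.+1) by apply: subseq_iota2; lia.
    split.
    - by have := pos a; rewrite rI mem_head => /(_ isT); lia.
    - by rewrite -/(iota a k.+1) mem_iota; lia.
    - by rewrite (@subseq2_asym w i.-1 i) //; [lia | apply: subseq_trans s2 rw].
  have [a [k rI]] : exists a k, r = rev (iota a k.+1).
    by exists (last 0 r), (size r).-1; rewrite prednK // -rE revK.
  move: ir il rw; rewrite /low rI last_rev_iotaS head_rev_iotaS mem_rev mem_iota.
  move=> ir il rw; have lt_ai : a < i by lia.
  have s2 : subseq [:: i; i.-1] (rev (iota a k.+1)).
    by rewrite -subseq_rev revK; apply: subseq_iota2; lia.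
  split.
  - by have := pos a; rewrite rI mem_rev mem_head => /(_ isT); lia.
  - by rewrite mem_rev mem_iota; lia.
  - by rewrite (subseq_trans s2 rw).
apply: leq_trans (cost_le_starts (start := [in map low rs]) _) _; last first.
  rewrite -size_filter -(size_map low rs); apply: uniq_leq_size.
    by rewrite filter_uniq ?iota_uniq.
  by move=> j; rewrite mem_filter => /andP[].
move=> j jn cj jlow.
have jw : j \in w by apply: contra_notT cj; rewrite /side_of => ->.
have [r rin jr] := flattenP jw.
have lowN i : i \in r -> i \notin map low rs -> i != low r.
  by move=> _; apply: contraNneq => ->; apply: map_f.
have [j1 pr ->] := sideE r j rin jr (lowN _ jr jlow).
split=> //.
  rewrite /side_of (mem_subseq (subseq_flatten rin)) //=.
  by case: ifP.
have [|jl] := boolP (j.-1 \in map low rs); [by left | right].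
by have [_ _ ->] := sideE r j.-1 rin pr (lowN _ pr jl).
Qed.

(** * The second row and the run number *)

Theorem theorem6p4 (n : nat) (v : {perm 'I_n}) :
  boolean_perm v -> is_run_number v (lambda_ v 2).
Proof.
move=> bv; have [w rw] := reduced_word_exists v.
(* Every reduced word of [v] yields the same cost, so the bound below may be taken on the word of an
   arbitrary competing decomposition. *)
have lam w' : reduced_word v w' -> lambda_ v 2 = cost (side_of w') n.-1.
  by move=> rw'; have [ww <- _] := rw'; apply: lambda2_cost => //; apply: bv.
split.
  have [rs [sz runs pe we _]] := greedy_runs (side_of w) (leqnn n.-1).
  have [ww _ _] := rw.
  have [pb wb] := build_word ww (bv _ rw).
  exists rs; split=> //; first by rewrite (lam w).
  (* The concatenated runs rearrange the letters of [w] with the same product, so they have minimal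
     length too. *)
  apply: (reduced_word_perm rw); last by rewrite we wb.
  by rewrite (perm_trans pe) // perm_sym.
move=> k [rs [<- runs rrs]]; rewrite (lam _ rrs).
by have [ww _ _] := rrs; apply: cost_le_runs => //; apply: bv.
Qed.
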